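(* Let $A,B\in\mathcal{M}_n^+$. Then $$A\sharp B-A!B\;\le\;\frac18(A-B)(A\sharp B)^{-1}(A-B).$$
   Context: $\mathcal{M}_n^+$ denotes the set of positive (definite) $n\times n$ complex matrices: $A\in\mathcal{M}_n^+$ iff $\langle Ax,x\rangle>0$ for all nonzero $x\in\mathbb{C}^n$. For Hermitian matrices, $X\le Y$ means that $Y-X$ is positive semidefinite. For $A,B\in\mathcal{M}_n^+$, the geometric mean is $A\sharp B=A^{1/2}\left(A^{-1/2}BA^{-1/2}\right)^{1/2}A^{1/2}$ and the harmonic mean is $A!B=\left(\frac{A^{-1}+B^{-1}}{2}\right)^{-1}$. *)

(* Defs.v *)
From HB Require Import structures.
From mathcomp Require Import all_boot all_order all_algebra.
From mathcomp Require Import complex.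
From mathcomp Require Import reals.

Set Implicit Arguments.
Unset Strict Implicit.
Unset Printing Implicit Defensive.

Import Order.TTheory GRing.Theory Num.Theory.

Local Open Scope ring_scope.
Local Open Scope sesquilinear_scope.

Section MatrixMeans.
Context {C : numClosedFieldType} {n : nat}.
Implicit Types (A B X Y : 'M[C]_n) (x y : 'cV[C]_n).

Definition inner x y : C := (y ^t* *m x) 0 0.

(* In a numClosedFieldType the order is partial: [0 < z] and [0 <= z] include
   the assertion that z is real. *)
Definition posdef A : Prop := forall x, x != 0 -> 0 < inner (A *m x) x.

Definition possemidef A : Prop := forall x, 0 <= inner (A *m x) x.

Definition loewner_le X Y : Prop := possemidef (Y - X).

(* The functional calculus t |-> t^(1/2) on a unitary diagonalization.
   [sqrtmxP] and [sqrtmx_unique] show that on positive semidefinite matrices it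
   is the unique positive semidefinite square root. *)
Definition sqrtmx A : 'M[C]_n :=
  invmx (spectralmx A) *m diag_mx (map_mx sqrtC (spectral_diag A))
    *m spectralmx A.

Definition geomean A B : 'M[C]_n :=
  let S := sqrtmx A in
  S *m sqrtmx (invmx S *m B *m invmx S) *m S.

Definition harmean A B : 'M[C]_n := invmx (2^-1 *: (invmx A + invmx B)).

Lemma posdefW A : posdef A -> possemidef A.
Proof.
move=> hA x; have [->|/hA/ltW //] := eqVneq x 0.
by rewrite /inner mulmx0 mulmx0 mxE.
Qed.

Lemma possemidef_hermsym A : possemidef A -> A \is hermsymmx.
Proof.
move=> hA; apply/is_hermitianmxP; rewrite expr0 scale1r.
pose q x y : C := (x ^t* *m (A - A ^t*) *m y) 0 0.
have q0 x : q x x = 0.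
  have /ger0_real/CrealP := hA x.
  have -> : (inner (A *m x) x)^* = ((x ^t* *m (A *m x)) ^t*) 0 0.
    by rewrite [RHS]mxE [in RHS]mxE.
  rewrite !(map_mxM, trmx_mul) trmxCK /inner => e.
  rewrite /q mulmxBr mulmxBl mxE [X in _ + X]mxE; apply/eqP.
  by rewrite subr_eq0 -mulmxA e.
have qDl x y z : q (x + y) z = q x z + q y z.
  by rewrite /q [(x + y)^T]linearD map_mxD !mulmxDl mxE.
have qDr x y z : q x (y + z) = q x y + q x z by rewrite /q mulmxDr mxE.
have qZl a x z : q (a *: x) z = a^* * q x z.
  by rewrite /q [(a *: x)^T]linearZ /= map_mxZ -!scalemxAl mxE.
have qZr a x z : q x (a *: z) = a * q x z by rewrite /q -scalemxAr mxE.
have qs x y : q x y + q y x = 0.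
  by have := q0 (x + y); rewrite qDl !qDr !q0 add0r addr0.
have qN x y : q x y = 0.
  have := qs ('i *: x) y; rewrite qZl qZr conjCi mulNr addrC -mulrBr => /eqP.
  rewrite mulf_eq0 (negPf (neq0Ci _)) /= subr_eq0 => /eqP e.
  have /eqP := qs x y; rewrite e -mulr2n mulrn_eq0 /= => /eqP //.
apply/eqP; rewrite -subr_eq0; apply/eqP/matrixP=> i j.
have := qN (delta_mx i 0) (delta_mx j 0).
rewrite /q trmx_delta map_delta_mx -rowE -colE => e.
by rewrite [RHS]mxE -[RHS]e !mxE.
Qed.

Lemma possemidef_spectral A : possemidef A ->
  A = invmx (spectralmx A) *m diag_mx (spectral_diag A) *m spectralmx A.
Proof.
by move/possemidef_hermsym/hermitian_normalmx/orthomx_spectralP.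
Qed.

Lemma possemidef_spectral_diag A i : possemidef A -> 0 <= spectral_diag A 0 i.
Proof.
move=> hA; have := hA ((spectralmx A) ^t* *m delta_mx i 0).
rewrite {1}(possemidef_spectral hA) /inner trmx_mul map_mxM trmxCK.
rewrite -(invmx_unitary (spectral_unitarymx A)) !mulmxA.
rewrite !mulmxK ?spectral_unit // trmx_delta map_delta_mx -rowE -colE !mxE.
by rewrite eqxx.
Qed.

Lemma sqrtmxP A : possemidef A ->
  possemidef (sqrtmx A) /\ sqrtmx A *m sqrtmx A = A.
Proof.
move=> hA; split; last first.
  rewrite [RHS](possemidef_spectral hA) /sqrtmx !mulmxA.
  rewrite mulmxK ?spectral_unit //; congr (_ *m _).
  rewrite -!mulmxA mulmx_diag; congr (_ *m diag_mx _).
  by apply/rowP=> i; rewrite !mxE -expr2 sqrtCK.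
move=> x; rewrite /inner /sqrtmx (invmx_unitary (spectral_unitarymx A)).
set U := spectralmx A; rewrite !mulmxA.
have -> : x ^t* *m U ^t* = (U *m x) ^t* by rewrite trmx_mul map_mxM.
rewrite -mulmxA mxE sumr_ge0 // => i _.
rewrite mul_mx_diag !mxE mulrAC.
rewrite mulr_ge0 ?sqrtC_ge0 ?possemidef_spectral_diag //.
by rewrite mulrC mul_conjC_ge0.
Qed.

Lemma sqrtmx_unique A X : possemidef X -> X *m X = A -> X = sqrtmx A.
Proof.
move=> hX XA.
have hA : possemidef A.
  move=> x; have /is_hermitianmxP := possemidef_hermsym hX.
  rewrite expr0 scale1r => Xh.
  rewrite /inner -XA -mulmxA mulmxA {1}Xh -map_mxM -trmx_mul mxE.
  by rewrite sumr_ge0 // => i _; rewrite !mxE mulrC mul_conjC_ge0.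
have := (spectral_unit A, spectral_unit X).
have := (possemidef_spectral hA, possemidef_spectral hX).
have dA := possemidef_spectral_diag _ hA.
have dX := possemidef_spectral_diag _ hX.
rewrite /sqrtmx; move: (spectralmx A) (spectralmx X) dA dX.
move: (spectral_diag A) (spectral_diag X) => a b U V dA dX [eA eX] [U1 V1].
pose W := U *m invmx V.
have eW : diag_mx a *m W = W *m diag_mx b *m diag_mx b.
  have -> : diag_mx a *m W = U *m A *m invmx V.
    by rewrite eA /W !mulmxA mulmxV // mul1mx.
  by rewrite -XA {1 2}eX /W !mulmxA !mulmxK.
have eW2 : diag_mx (map_mx sqrtC a) *m W = W *m diag_mx b.
  apply/matrixP => i j; move/matrixP/(_ i j): eW.
  rewrite !mul_diag_mx !mul_mx_diag !mxE.
  set w := (\sum_ _ _).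
  have [->|w0] := eqVneq w 0; first by rewrite !(mulr0, mul0r).
  rewrite mulrC -mulrA => /(mulfI w0) ->.
  by rewrite -expr2 sqrCK // mulrC.
rewrite eX; apply: (can_inj (mulKmx U1)).
rewrite !mulmxA mulmxV // mul1mx -/W -eW2 /W.
by rewrite -!mulmxA mulVmx // mulmx1.
Qed.

End MatrixMeans.

(* Main.v *)
(** Put [S = A^(1/2)] and diagonalize [S^-1 B S^-1] by a unitary [U], with
    eigenvalues [d^2].  With [P = U S], one has [A = P^* P],
    [B = P^* diag(d^2) P] and [A # B = P^* diag(d) P], so the inequality is the
    congruence by [P] of an inequality between diagonal matrices. Entrywise it
    is [d - 2 d^2 / (1 + d^2) <= (1 - d^2)^2 / (8 d)], and the difference of
    the two sides is [(1 - d)^4 (d^2 + 4 d + 1) / (8 d (1 + d^2))]. *)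
Require Import Defs.
From mathcomp Require Import all_boot all_order all_algebra.
From mathcomp Require Import complex.
From mathcomp Require Import reals.
From mathcomp Require Import ring.
Import Order.TTheory GRing.Theory Num.Theory.
Local Open Scope ring_scope.
Local Open Scope sesquilinear_scope.

Section Congruence.
Set Implicit Arguments.
Unset Strict Implicit.
Context {C : numClosedFieldType} {n : nat}.
Implicit Types (A B M P : 'M[C]_n) (d e : 'rV[C]_n).

Lemma inner_congr A M (x : 'cV[C]_n) :
  inner (M ^t* *m A *m M *m x) x = inner (A *m (M *m x)) (M *m x).
Proof. by rewrite /inner trmx_mul map_mxM !mulmxA. Qed.

Lemma possemidef_congr A M : possemidef A -> possemidef (M ^t* *m A *m M).
Proof. by move=> hA x; rewrite inner_congr. Qed.

Lemma posdef_congr A M :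
  M \in unitmx -> posdef A -> posdef (M ^t* *m A *m M).
Proof.
move=> uM hA x x0; rewrite inner_congr; apply: hA.
by apply: contra_neq x0 => /(congr1 (mulmx (invmx M))); rewrite mulKmx // mulmx0.
Qed.

Lemma possemidef_diag_mx d :
  (forall i, 0 <= d 0 i) -> possemidef (diag_mx d).
Proof.
move=> hd x; rewrite /inner mul_diag_mx mxE sumr_ge0 // => i _.
by rewrite !mxE mulrCA mulr_ge0 // mulrC mul_conjC_ge0.
Qed.

(** Congruence by the adjoint of the spectral unitary makes [A] diagonal and keeps it positive
    definite; its form at the [i]-th basis vector is the [i]-th eigenvalue. *)
Lemma posdef_spectral_diag A i : posdef A -> 0 < spectral_diag A 0 i.
Proof.
move=> hA; have uU := spectral_unit A.
have eU := invmx_unitary (spectral_unitarymx A).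
have uV : (spectralmx A) ^t* \in unitmx by rewrite -eU unitmx_inv.
have := posdef_congr uV hA.
rewrite trmxCK {2}(possemidef_spectral (posdefW hA)) -eU !mulmxA mulmxV //.
rewrite mul1mx mulmxK // => /(_ (delta_mx i 0)).
rewrite /inner trmx_delta map_delta_mx -rowE -colE !mxE eqxx; apply.
by apply/eqP => /matrixP/(_ i 0)/eqP; rewrite !mxE !eqxx oner_eq0.
Qed.

Lemma unitmx_diag_mx d : (forall i, d 0 i != 0) -> diag_mx d \in unitmx.
Proof.
by move=> hd; rewrite unitmxE det_diag unitfE; apply/prodf_neq0 => i _.
Qed.

Lemma invmx_diag_mx d : (forall i, d 0 i != 0) ->
  invmx (diag_mx d) = diag_mx (map_mx GRing.inv d).
Proof.
move=> hd; apply: (can_inj (mulKmx (unitmx_diag_mx hd))).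
rewrite mulmxV ?unitmx_diag_mx // mulmx_diag -diag_const_mx.
by congr diag_mx; apply/rowP => i; rewrite !mxE divff.
Qed.

Lemma posdef_unitmx A : posdef A -> A \in unitmx.
Proof.
move=> hA; rewrite (possemidef_spectral (posdefW hA)) !unitmx_mul unitmx_inv.
rewrite !spectral_unit andbT /=; apply: unitmx_diag_mx => i.
by rewrite gt_eqF // posdef_spectral_diag.
Qed.

Lemma unitmx_trmxC P : P \in unitmx -> P ^t* \in unitmx.
Proof. by move=> uP; rewrite map_unitmx unitmx_tr. Qed.

Lemma invmx_mulmx A B : A \in unitmx -> B \in unitmx ->
  invmx (A *m B) = invmx B *m invmx A.
Proof.
move=> uA uB; have uAB : A *m B \in unitmx by rewrite unitmx_mul uA.
apply: (can_inj (mulKmx uAB)).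
by rewrite mulmxV // mulmxA mulmxK // mulmxV.
Qed.

(** The outer factors come out as the inverses of [P] and [P ^t*], ready to cancel against those of
    [A - B] on either side. *)
Lemma invmx_congr_diag P d : P \in unitmx -> (forall i, d 0 i != 0) ->
  invmx (P ^t* *m diag_mx d *m P) =
  invmx P *m diag_mx (map_mx GRing.inv d) *m invmx (P ^t*).
Proof.
move=> uP hd; have uD := unitmx_diag_mx hd; have uQ := unitmx_trmxC uP.
by rewrite !invmx_mulmx ?unitmx_mul ?uQ // invmx_diag_mx // mulmxA.
Qed.

Lemma geomean_codiag A B : posdef A -> posdef B ->
  exists P d, [/\ P \in unitmx, forall i, 0 < d 0 i,
    A = P ^t* *m P,
    B = P ^t* *m diag_mx (map_mx (fun z => z ^+ 2) d) *m P
  & geomean A B = P ^t* *m diag_mx d *m P].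
Proof.
move=> hA hB; have [hS SS] := sqrtmxP (posdefW hA).
rewrite /geomean; move: (sqrtmx A) hS SS => S hS SS.
have uS : S \in unitmx.
  by have := posdef_unitmx hA; rewrite -SS unitmx_mul andbb.
have Sh : S ^t* = S.
  by have /is_hermitianmxP := possemidef_hermsym hS; rewrite expr0 scale1r.
have Vh : (invmx S) ^t* = invmx S by rewrite trmx_inv map_invmx Sh.
set T := invmx S *m B *m invmx S.
have hT : posdef T.
  (* As [invmx S] is Hermitian, [T] is a congruence of [B]. *)
  by rewrite /T -{1}Vh; apply: posdef_congr; rewrite ?unitmx_inv.
have eU := invmx_unitary (spectral_unitarymx T).
have uU := spectral_unit T.
have eP : (spectralmx T *m S) ^t* = S *m invmx (spectralmx T).
  by rewrite trmx_mul map_mxM Sh eU.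
exists (spectralmx T *m S), (map_mx sqrtC (spectral_diag T)).
rewrite eP; split.
- by rewrite unitmx_mul uU.
- by move=> i; rewrite mxE sqrtC_gt0 posdef_spectral_diag.
- by rewrite mulmxA mulmxKV.
- have -> : B = S *m T *m S.
    by rewrite /T !mulmxA mulmxV // mul1mx mulmxKV.
  rewrite {1}(possemidef_spectral (posdefW hT)) !mulmxA.
  congr (_ *m diag_mx _ *m _ *m _).
  by apply/rowP => i; rewrite !mxE sqrtCK.
(* [sqrtmx T] is built on the same unitary and has diagonal [d], so only associativity is left. *)
- by rewrite /sqrtmx !mulmxA.
Qed.

(** Both inverses share the same outer factors, so their mean is taken on the diagonals; inverting
    again restores [P ^t*] and [P]. *)
Lemma harmean_congr_diag P d e : P \in unitmx ->
  (forall i, 0 < d 0 i) -> (forall i, 0 < e 0 i) ->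
  harmean (P ^t* *m diag_mx d *m P) (P ^t* *m diag_mx e *m P) =
  P ^t* *m diag_mx (\row_i (2^-1 * ((d 0 i)^-1 + (e 0 i)^-1))^-1) *m P.
Proof.
move=> uP hd he; have uQ := unitmx_trmxC uP.
have nz (f : 'rV[C]_n) : (forall i, 0 < f 0 i) -> forall i, f 0 i != 0.
  by move=> hf i; rewrite gt_eqF.
rewrite /harmean !invmx_congr_diag; try exact: nz; try done.
set h := \row__ _.
have hh i : 0 < h 0 i.
  by rewrite mxE invr_gt0 mulr_gt0 ?invr_gt0 ?ltr0n ?addr_gt0 ?invr_gt0.
(* With the right side as a double inverse, it suffices to compare the matrices under the outer
   [invmx]. *)
rewrite -[RHS]invmxK invmx_congr_diag //; last exact: nz.
rewrite -mulmxDl -mulmxDr -linearD /= scalemxAl scalemxAr -linearZ /=.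
congr (invmx (_ *m diag_mx _ *m _)).
by apply/rowP => i; rewrite !mxE invrK.
Qed.

End Congruence.

Lemma geo_harm_gap_ge0 (C : numFieldType) (q : C) : 0 < q ->
  0 <= 8^-1 * ((1 - q ^+ 2) * q^-1 * (1 - q ^+ 2))
       - (q - (2^-1 * (1^-1 + (q ^+ 2)^-1))^-1).
Proof.
move=> q0; have p0 : 0 < 1 + q ^+ 2 by rewrite addr_gt0 ?exprn_gt0.
have -> : 8^-1 * ((1 - q ^+ 2) * q^-1 * (1 - q ^+ 2))
       - (q - (2^-1 * (1^-1 + (q ^+ 2)^-1))^-1) =
  ((1 - q) ^+ 2) ^+ 2 * (q ^+ 2 + 4 * q + 1) / (8 * q * (1 + q ^+ 2)).
  by field; rewrite !gt_eqF.
(* The order is partial, so the even power of [1 - q] is nonnegative only once [1 - q] is known to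
   be real. *)
have r1 : 1 - q \is Num.real by rewrite rpredB ?rpred1 ?gtr0_real.
have q1 : 0 <= q := ltW q0.
apply: divr_ge0; last by rewrite mulr_ge0 ?mulr_ge0 // ltW.
apply: mulr_ge0; first by rewrite exprn_ge0 // real_exprn_even_ge0.
by rewrite !addr_ge0 ?exprn_ge0 // mulr_ge0.
Qed.

Theorem theorem2p4 (R : realType) (n : nat) (A B : 'M[R[i]]_n)
  (hA : posdef A) (hB : posdef B) :
  loewner_le (geomean A B - harmean A B)
             (8^-1 *: ((A - B) *m invmx (geomean A B) *m (A - B))).
Proof.
have [P [d [uP hd eA eB eG]]] := geomean_codiag hA hB.
have uQ := unitmx_trmxC uP.
(* The identity is written as a diagonal of ones, giving [A] the same shape as [B]; hence the [1^-1]
   in [geo_harm_gap_ge0]. *)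
have {}eA : A = P ^t* *m diag_mx (const_mx 1) *m P.
  by rewrite diag_const_mx mulmx1.
have nz i : d 0 i != 0 by rewrite gt_eqF.
rewrite /loewner_le eG eA eB harmean_congr_diag //; first last.
- by move=> i; rewrite mxE exprn_gt0.
- by move=> i; rewrite mxE.
have diagB (u v : 'rV[R[i]]_n) : diag_mx u - diag_mx v = diag_mx (u - v).
  by rewrite linearB.
rewrite invmx_congr_diag // -!mulmxBl -!mulmxBr !diagB !mulmxA.
(* The inner [P] and [P ^t*] cancel, leaving a product of three diagonal matrices between [P ^t*]
   and [P]. *)
rewrite mulmxK // mulmxKV // -(mulmxA _ (diag_mx _) (diag_mx _)) mulmx_diag.
rewrite -(mulmxA _ (diag_mx _) (diag_mx _)) mulmx_diag.
have -> (u : 'rV[R[i]]_n) : 8^-1 *: (P ^t* *m diag_mx u *m P) =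
    P ^t* *m diag_mx (8^-1 *: u) *m P.
  by rewrite scalemxAl scalemxAr -linearZ.
rewrite -mulmxBl -mulmxBr diagB.
apply/possemidef_congr/possemidef_diag_mx => i.
by rewrite !mxE mulrA; exact: geo_harm_gap_ge0.
Qed.
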